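(* Let $\mathcal{F}_1, \dots, \mathcal{F}_5$ be families of compact connected sets in $\mathbb{R}^2$. Suppose that for every choice of indices $1 \leq i_1 < i_2 < i_3 \leq 5$ and every three sets $F_1 \in \mathcal{F}_{i_1}$, $F_2 \in \mathcal{F}_{i_2}$, $F_3 \in \mathcal{F}_{i_3}$, there exists a line intersecting each of $F_1, F_2, F_3$. Then there exists $i \in \{1,\dots,5\}$ such that $\mathcal{F}_i$ can be pierced by 3 lines that are either concurrent or all parallel.
   Context: A family is pierced by $k$ lines if there exist $k$ lines whose union intersects every set in the family. Lines are concurrent if they all pass through a single common point. *)

(* Defs.v *)
From HB Require Import structures.
From mathcomp Require Import all_boot all_order all_algebra.
From mathcomp Require Import all_classical all_reals all_analysis.
Set Implicit Arguments.
Unset Strict Implicit.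
Unset Printing Implicit Defensive.
Import Order.TTheory GRing.Theory Num.Theory.
Import numFieldNormedType.Exports.
Local Open Scope classical_set_scope.
Local Open Scope ring_scope.

Definition line (R : realType) (p d : 'rV[R]_2) : set 'rV[R]_2 :=
  [set p + t *: d | t in [set: R]].

Definition is_line (R : realType) (l : set 'rV[R]_2) : Prop :=
  exists p d : 'rV[R]_2, d != 0 /\ l = line p d.

Definition concurrent (R : realType) (k : nat) (L : 'I_k -> set 'rV[R]_2) : Prop :=
  exists p : 'rV[R]_2, forall j, L j p.

Definition all_parallel (R : realType) (k : nat) (L : 'I_k -> set 'rV[R]_2) : Prop :=
  exists2 d : 'rV[R]_2, d != 0 & forall j, exists p, L j = line p d.

(* Injectivity says that these really are k lines, not at most k. *)
Definition k_lines (R : realType) (k : nat) (L : 'I_k -> set 'rV[R]_2) : Prop :=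
  injective L /\ forall j, is_line (L j).

Definition pierces (R : realType) (k : nat) (L : 'I_k -> set 'rV[R]_2)
    (F : set (set 'rV[R]_2)) : Prop :=
  forall A, F A -> (\bigcup_(j in [set: 'I_k]) L j) `&` A !=set0.

(* Main.v *)
Require Import Defs.
From HB Require Import structures.
From mathcomp Require Import all_boot all_order all_algebra.
From mathcomp Require Import all_classical all_reals all_analysis.
From mathcomp Require Import ring lra zify.
Import Order.TTheory GRing.Theory Num.Theory.
Import numFieldNormedType.Exports.
Local Open Scope classical_set_scope.
Local Open Scope ring_scope.

(** Suppose that no [F i] is pierced. By compactness of the space of triples of
concurrent projective lines there is a bounded box such that, for every [i] and
every triple of concurrent lines, some member of [F i] inside the box avoids
the three lines, hence lies in one of the six open sectors they cut out.

Take triples through a variable point [p] of a larger square, one of the lines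
being horizontal: this is a 4-dimensional cube of configurations. For each [i]
take a partition of unity subordinate to the cover of the cube by the open sets
"sector [j] contains a member of [F i]", and let [f j] be the sum over [i] of
the resulting weights. The Poincare-Miranda theorem yields a configuration with
[f 0 = f 2 = f 4] and [f 1 = f 3 = f 5]. These two common values add up to
[5 / 3], so one of them is at least [5 / 6], and Hall's condition provides three
distinct families with members in the sectors 0, 2, 4 (or 1, 3, 5). No line
meets three alternate sectors.

The Poincare-Miranda theorem follows from a discrete degree formula: for
functions [e, f, g, h] on a grid, the cup product of their coboundaries is
itself a coboundary, so its sum over the grid only depends on the boundary
values. *)

(** * A discrete degree formula *)

(* [cupN e1 .. eN] at a grid point is the value, on the unit cube whose lowest
corner is that point, of the cubical cup product [d e1 \cup .. \cup d eN]. *)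
Definition cup1 (K : comNzRingType) (e : nat -> K) x : K := e x.+1 - e x.

Definition cup2 (K : comNzRingType) (e f : nat -> nat -> K) x y : K :=
  (e x.+1 y - e x y) * cup1 K (f x.+1) y
  - (e x y.+1 - e x y) * cup1 K (f^~ y.+1) x.

Definition cup3 (K : comNzRingType) (e f g : nat -> nat -> nat -> K) x y z
  : K :=
  (e x.+1 y z - e x y z) * cup2 K (f x.+1) (g x.+1) y z
  - (e x y.+1 z - e x y z) * cup2 K (f^~ y.+1) (g^~ y.+1) x z
  + (e x y z.+1 - e x y z) *
    cup2 K (fun x y => f x y z.+1) (fun x y => g x y z.+1) x y.

Definition cup4 (K : comNzRingType) (e f g h : nat -> nat -> nat -> nat -> K)
    x y z t : K :=
  (e x.+1 y z t - e x y z t) * cup3 K (f x.+1) (g x.+1) (h x.+1) y z t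
  - (e x y.+1 z t - e x y z t) *
    cup3 K (f^~ y.+1) (g^~ y.+1) (h^~ y.+1) x z t
  + (e x y z.+1 t - e x y z t) *
    cup3 K (fun x y => f x y z.+1) (fun x y => g x y z.+1)
      (fun x y => h x y z.+1) x y t
  - (e x y z t.+1 - e x y z t) *
    cup3 K (fun x y z => f x y z t.+1) (fun x y z => g x y z t.+1)
      (fun x y z => h x y z t.+1) x y z.

(* This says that [d e \cup d f \cup d g \cup d h = d (e \cup d f \cup d g \cup d h)]. *)
Lemma cup4E (K : comNzRingType) (e f g h : nat -> nat -> nat -> nat -> K)
    x y z t :
  let A i := e i y z t * cup3 K (f i) (g i) (h i) y z t in
  let B i := e x i z t * cup3 K (f^~ i) (g^~ i) (h^~ i) x z t in
  let C i := e x y i t * cup3 K (fun x y => f x y i) (fun x y => g x y i)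
      (fun x y => h x y i) x y t in
  let D i := e x y z i * cup3 K (fun x y z => f x y z i)
     (fun x y z => g x y z i) (fun x y z => h x y z i) x y z in
  cup4 K e f g h x y z t =
    A x.+1 - A x - (B y.+1 - B y) + (C z.+1 - C z) - (D t.+1 - D t).
Proof. rewrite /cup4 /cup3 /cup2 /cup1 /=. ring. Qed.

Section Degree.
Variables (K : comNzRingType) (n : nat).

Lemma sum_cup1 (e : nat -> K) : e 0%N = 0 -> e n = 1 ->
  \sum_(0 <= x < n) cup1 K e x = 1.
Proof. by move=> e0 en; rewrite /cup1 telescope_sumr // e0 en subr0. Qed.

(** As a coboundary, the sum telescopes to the faces of the grid. On the faces [y = 0] and [y = n]
    the function [f] is constant, so [B] contributes nothing. The face [x = 0] has [e = 0], and the
    face [x = n] has [e = 1], which leaves the sum of one dimension less for [f n]. The same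
    induction on the dimension gives the next two lemmas. *)
Lemma sum_cup2 (e f : nat -> nat -> K) :
    (forall y, e 0%N y = 0) -> (forall y, e n y = 1) ->
    (forall x, f x 0%N = 0) -> (forall x, f x n = 1) ->
  \sum_(0 <= x < n) \sum_(0 <= y < n) cup2 K e f x y = 1.
Proof.
move=> e0 en f0 fn.
pose A i y := e i y * cup1 K (f i) y; pose B x i := e x i * cup1 K (f^~ i) x.
have E x y : cup2 K e f x y = A x.+1 y - A x y - (B x y.+1 - B x y).
  by rewrite /A /B /cup2 /cup1; ring.
under eq_bigr do under eq_bigr do rewrite E.
under eq_bigr do rewrite sumrB.
rewrite sumrB exchange_big /= -[RHS]subr0; congr (_ - _).
  under eq_bigr do rewrite telescope_sumr // /A e0 en mul0r mul1r subr0.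
  exact: sum_cup1.
rewrite big1// => x _; rewrite telescope_sumr // /B /cup1 !f0 !fn; ring.
Qed.

Lemma sum_cup3 (e f g : nat -> nat -> nat -> K) :
    (forall y z, e 0%N y z = 0) -> (forall y z, e n y z = 1) ->
    (forall x z, f x 0%N z = 0) -> (forall x z, f x n z = 1) ->
    (forall x y, g x y 0%N = 0) -> (forall x y, g x y n = 1) ->
  \sum_(0 <= x < n) \sum_(0 <= y < n) \sum_(0 <= z < n) cup3 K e f g x y z = 1.
Proof.
move=> e0 en f0 fn g0 gn.
pose A i y z := e i y z * cup2 K (f i) (g i) y z.
pose B x i z := e x i z * cup2 K (f^~ i) (g^~ i) x z.
pose C x y i := e x y i * cup2 K (fun x y => f x y i) (fun x y => g x y i) x y.
have E x y z : cup3 K e f g x y z =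
    A x.+1 y z - A x y z - (B x y.+1 z - B x y z) + (C x y z.+1 - C x y z).
  by rewrite /A /B /C /cup3 /cup2 /cup1; ring.
under eq_bigr do under eq_bigr do under eq_bigr do rewrite E.
under eq_bigr do under eq_bigr do rewrite big_split sumrB /=.
under eq_bigr do rewrite big_split sumrB /=.
rewrite big_split sumrB /=.
rewrite [X in _ - X]big1 => [|x _]; last first.
  rewrite exchange_big big1//= => z _.
  by rewrite telescope_sumr // /B /cup2 /cup1 !f0 !fn; ring.
rewrite [X in _ + X]big1 => [|x _]; last first.
  rewrite big1// => y _.
  by rewrite telescope_sumr // /C /cup2 /cup1 !g0 !gn; ring.
rewrite subr0 addr0 exchange_big /=.
under eq_bigr do rewrite exchange_big /=.
under eq_bigr do under eq_bigr do
  rewrite telescope_sumr // /A e0 en mul0r mul1r subr0.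
exact: sum_cup2.
Qed.

Lemma sum_cup4 (e f g h : nat -> nat -> nat -> nat -> K) :
    (forall y z t, e 0%N y z t = 0) -> (forall y z t, e n y z t = 1) ->
    (forall x z t, f x 0%N z t = 0) -> (forall x z t, f x n z t = 1) ->
    (forall x y t, g x y 0%N t = 0) -> (forall x y t, g x y n t = 1) ->
    (forall x y z, h x y z 0%N = 0) -> (forall x y z, h x y z n = 1) ->
  \sum_(0 <= x < n) \sum_(0 <= y < n) \sum_(0 <= z < n) \sum_(0 <= t < n)
    cup4 K e f g h x y z t = 1.
Proof.
move=> e0 en f0 fn g0 gn h0 hn.
pose A i y z t := e i y z t * cup3 K (f i) (g i) (h i) y z t.
pose B x i z t := e x i z t * cup3 K (f^~ i) (g^~ i) (h^~ i) x z t.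
pose C x y i t := e x y i t * cup3 K (fun x y => f x y i) (fun x y => g x y i)
  (fun x y => h x y i) x y t.
pose D x y z i := e x y z i * cup3 K (fun x y z => f x y z i)
  (fun x y z => g x y z i) (fun x y z => h x y z i) x y z.
have E x y z t : cup4 K e f g h x y z t =
    A x.+1 y z t - A x y z t - (B x y.+1 z t - B x y z t)
    + (C x y z.+1 t - C x y z t) - (D x y z t.+1 - D x y z t).
  exact: cup4E.
under eq_bigr do under eq_bigr do under eq_bigr do under eq_bigr do rewrite E.
under eq_bigr do under eq_bigr do under eq_bigr do
  rewrite sumrB big_split /= sumrB.
under eq_bigr do under eq_bigr do rewrite sumrB big_split /= sumrB.
under eq_bigr do rewrite sumrB big_split /= sumrB.
rewrite sumrB big_split /= sumrB.
rewrite [X in _ - X + _]big1 => [|x _]; last first.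
  rewrite exchange_big big1//= => z _; rewrite exchange_big big1//= => t _.
  by rewrite telescope_sumr // /B /cup3 /cup2 /cup1 !f0 !fn; ring.
rewrite [X in _ + X - _]big1 => [|x _]; last first.
  rewrite big1// => y _; rewrite exchange_big big1//= => t _.
  by rewrite telescope_sumr // /C /cup3 /cup2 /cup1 !g0 !gn; ring.
rewrite [X in _ - X]big1 => [|x _]; last first.
  rewrite big1// => y _; rewrite big1// => z _.
  by rewrite telescope_sumr // /D /cup3 /cup2 /cup1 !h0 !hn; ring.
rewrite !subr0 addr0 exchange_big /=.
under eq_bigr do rewrite exchange_big /=.
under eq_bigr do under eq_bigr do rewrite exchange_big /=.
under eq_bigr do under eq_bigr do under eq_bigr do
  rewrite telescope_sumr // /A e0 en mul0r mul1r subr0.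
exact: sum_cup3.
Qed.

End Degree.

(** The coboundary of a function that is constant on the vertices of a cube vanishes on that cube,
    and with it every cup product having this factor. *)
Lemma cup4_const (K : comNzRingType) (e f g h : nat -> nat -> nat -> nat -> K)
    (c : K) x y z t :
    (exists2 l, List.In l [:: e; f; g; h] & forall i j k m : nat,
      (x <= i <= x.+1)%N -> (y <= j <= y.+1)%N ->
      (z <= k <= z.+1)%N -> (t <= m <= t.+1)%N -> l i j k m = c) ->
  cup4 K e f g h x y z t = 0.
Proof.
have le0 a : (a <= a <= a.+1)%N by rewrite leqnn leqnSn.
have le1 a : (a <= a.+1 <= a.+1)%N by rewrite leqnn leqnSn.
move=> [l]; rewrite /cup4 /cup3 /cup2 /cup1 => -[|[|[|[|[]]]]] <- E.
all: by rewrite !E //; ring.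
Qed.

(** A cubical form of Sperner's lemma. With labels read as 0 and 1 in the integers, the cup products
    sum to 1, so one of them is nonzero; by [cup4_const] none of the four labels is constant on that
    cube. *)
Lemma kuhn4 n (e f g h : nat -> nat -> nat -> nat -> bool) :
    (forall y z t, e 0%N y z t = false) -> (forall y z t, e n y z t = true) ->
    (forall x z t, f x 0%N z t = false) -> (forall x z t, f x n z t = true) ->
    (forall x y t, g x y 0%N t = false) -> (forall x y t, g x y n t = true) ->
    (forall x y z, h x y z 0%N = false) -> (forall x y z, h x y z n = true) ->
  exists x y z t, [/\ (x < n)%N, (y < n)%N, (z < n)%N, (t < n)%N &
    forall l, List.In l [:: e; f; g; h] -> forall b, exists i j k m,
    [/\ (x <= i <= x.+1)%N, (y <= j <= y.+1)%N, (z <= k <= z.+1)%N,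
        (t <= m <= t.+1)%N & l i j k m = b]].
Proof.
move=> e0 en f0 fn g0 gn h0 hn.
pose r (l : nat -> nat -> nat -> nat -> bool) x y z t : int := (l x y z t)%:R.
have S : \sum_(0 <= x < n) \sum_(0 <= y < n) \sum_(0 <= z < n) \sum_(0 <= t < n)
    cup4 int (r e) (r f) (r g) (r h) x y z t = 1.
  by apply: sum_cup4 => *; rewrite /r ?(e0, en, f0, fn, g0, gn, h0, hn).
apply: contrapT => N; move: S; rewrite big_nat big1 // => x /andP[_ xn].
rewrite big_nat big1 // => y /andP[_ yn]; rewrite big_nat big1 // => z /andP[_ zn].
rewrite big_nat big1 // => t /andP[_ tn].
apply: contrapT => C; apply: N; exists x, y, z, t; split=> // l El b.
apply: contrapT => N; apply: C; apply: (@cup4_const _ _ _ _ _ (~~ b)%:R).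
exists (r l); first by move: El => /= [|[|[|[|[]]]]] <-; intuition.
move=> i j k m xi yj zk tm; rewrite /r; congr (nat_of_bool _)%:R.
have [lb|] := eqVneq (l i j k m) b; first by case: N; exists i, j, k, m.
by case: b (l i j k m) {N} => -[].
Qed.

(** * The Poincare-Miranda theorem in dimension four *)

Definition unit_cube (R : realType) n : set 'rV[R]_n :=
  [set x | forall i, 0 <= x 0 i <= 1].

Lemma unit_cube_compact (R : realType) n : compact (unit_cube R n).
Proof.
have := @rV_compact R n (fun=> [set` `[0, 1]]) (fun=> @segment_compact R 0 1).
by congr compact; apply/seteqP; split=> x /= xc i; have := xc i; rewrite /= in_itv.
Qed.

Section PoincareMiranda.
Context (R : realType) (H : 'I_4 -> 'rV[R]_4 -> R).
Hypothesis H0 : forall i x, unit_cube R 4 x -> x 0 i = 0 -> 0 <= H i x.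
Hypothesis H1 : forall i x, unit_cube R 4 x -> x 0 i = 1 -> H i x <= 0.

Let sign_change (e : R) x := [/\ unit_cube R 4 x & forall i, exists u w,
  [/\ unit_cube R 4 u, unit_cube R 4 w, ball x e u, ball x e w &
      0 <= H i u /\ H i w <= 0]].

(** [kuhn4] is applied to the signs of the [H i] on the grid of mesh [1 / n.+1]. Vertices of one
    cell are at most one mesh apart, and the factor 2 makes the inequality strict. *)
Let sign_change_exists n : exists x, sign_change (2 / n.+1%:R) x.
Proof.
(* [kuhn4] labels all natural indices; truncating them at [n.+1] keeps every grid point in the
   cube. *)
pose G x y z t : 'rV[R]_4 :=
  \row_i ((minn (nth 0%N [:: x; y; z; t] i) n.+1)%:R / n.+1%:R).
have Gc x y z t : unit_cube R 4 (G x y z t).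
  move=> i; rewrite mxE divr_ge0 //= ler_pdivrMr // mul1r ler_nat.
  exact: geq_minr.
(* The label means [H i < 0], but is forced to be false at coordinate 0 and true from [n.+1] on. At
   these vertices [H0] and [H1] still give the weak sign that is wanted. *)
pose l (i : 'I_4) x y z t := let v := nth 0%N [:: x; y; z; t] i in
  (0 < v)%N && ((n.+1 <= v)%N || (H i (G x y z t) < 0)).
have := @kuhn4 n.+1 (l (inord 0)) (l (inord 1)) (l (inord 2)) (l (inord 3)).
rewrite /l !inordK //=.
case; rewrite ?ltnn ?leqnn // => x [y [z [t [xn yn zn tn C]]]].
exists (G x y z t); split=> // i.
have {}C b : exists i' j k m,
    [/\ (x <= i' <= x.+1)%N, (y <= j <= y.+1)%N, (z <= k <= z.+1)%N,
        (t <= m <= t.+1)%N & l i i' j k m = b].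
  apply: C; rewrite -(inord_val i) /l inordK //.
  by case: i => -[|[|[|[|//]]]] /= _; do ?[by left | right].
have B i' j k m : (x <= i' <= x.+1)%N -> (y <= j <= y.+1)%N ->
    (z <= k <= z.+1)%N -> (t <= m <= t.+1)%N ->
    ball (G x y z t) (2 / n.+1%:R) (G i' j k m).
  move=> ix jy kz mt; split=> [|r c]; first by rewrite divr_gt0.
  have K (a b : nat) : (a <= b <= a.+1)%N -> (a < n.+1)%N ->
      `|(minn a n.+1)%:R / n.+1%:R - (minn b n.+1)%:R / n.+1%:R| < 2 / n.+1%:R :> R.
    move=> ab an; rewrite -mulrBl normrM [X in _ * X]gtr0_norm //.
    rewrite ltr_pM2r // (minn_idPl (ltnW an)) (minn_idPl _); last lia.
    have [->|->] : b = a \/ b = a.+1 by lia.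
      by rewrite subrr normr0.
    by rewrite -natr1 opprD addrA subrr sub0r normrN normr1; lra.
  rewrite /ball /= !mxE; case: c => -[|[|[|[|//]]]] /= _; exact: K.
have [i1 [j1 [k1 [m1 [Bi Bj Bk Bm lF]]]]] := C false.
have [i2 [j2 [k2 [m2 [Bi' Bj' Bk' Bm' lT]]]]] := C true.
exists (G i1 j1 k1 m1), (G i2 j2 k2 m2); split=> //; try exact: B.
split.
  move: lF; rewrite /l; set v := nth _ _ _.
  case: (posnP v) => [v0 _|v_gt0 /= /norP[_]]; last by rewrite -leNgt.
  by apply: H0 => //; rewrite mxE -/v v0 min0n mul0r.
move: lT; rewrite /l; set v := nth _ _ _ => /andP[_ /orP[nv|/ltW//]].
by apply: H1 => //; rewrite mxE -/v (minn_idPr nv) divff.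
Qed.

(** Without a common zero, every point of the cube has some [H i] of strict constant sign on a ball
    around it, so no nearby point is a sign change at a small scale. Compactness makes the scale
    uniform, against [sign_change_exists]. *)
Theorem poincare_miranda4 :
  (forall i x, unit_cube R 4 x -> {for x, continuous (H i)}) ->
  exists2 x, unit_cube R 4 x & forall i, H i x = 0.
Proof.
move=> Hc; apply: contrapT => N.
have /compact_near_coveringP := @unit_cube_compact R 4.
move=> /(_ nat \oo (fun n x => ~ sign_change (2 / n.+1%:R) x)).
case=> [x xc|n _ /(_ n (leqnn n)) C]; last first.
  by have [x Qx] := sign_change_exists n; apply: (C x) => //; case: Qx.
have [i Hi] : exists i, H i x != 0.
  apply: contrapT => E; apply: N; exists x => // i.
  by apply: contra_notP E => /eqP; exists i.
have [d d0 Hd] : exists2 d : R, 0 < d & forall u w,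
    ball x d u -> ball x d w -> ~ (0 <= H i u /\ H i w <= 0).
  have [Hn|Hp] := ltP (H i x) 0.
    have /nbhs_ballP[d /= d0 sub] := Hc i x xc _ (lt_nbhsl Hn).
    exists d => // u w /sub /= ? _ [? _]; lra.
  have {}Hp : 0 < H i x by rewrite lt_neqAle eq_sym Hi.
  have /nbhs_ballP[d /= d0 sub] := Hc i x xc _ (lt_nbhsr Hp).
  by exists d => // u w _ /sub /= ? [_ ?]; lra.
have d20 : 0 < d / 2 by rewrite divr_gt0.
near=> x' n => -[_ /(_ i)[u [w [_ _ xu xw]]]].
have nd : 2 / n.+1%:R <= d / 2.
  rewrite (_ : d / 2 = 2 * (d / 4)); last by field.
  rewrite ler_pM2l // ltW //; near: n.
  exact: (near_infty_natSinv_lt (PosNum (divr_gt0 d0 (ltr0n _ 4)))).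
have xx' : ball x (d / 2) x' by near: x'; exact: nbhsx_ballx.
have D v : ball x' (2 / n.+1%:R) v -> ball x d v.
  by move=> /(le_ball nd) xv; rewrite [d]splitr; exact: ball_triangle xv.
by apply: Hd; exact: D.
Unshelve. all: by end_near. Qed.

End PoincareMiranda.

(** * Balanced configurations *)

Lemma open_cozero (R : realType) (V : normedModType R) (O : set V) : open O ->
  exists psi : V -> R, [/\ continuous psi, forall x, 0 <= psi x &
    forall x, 0 < psi x <-> O x].
Proof.
(* The distance to the complement of [O], capped at 1 in case [O] is everything. *)
move=> openO; pose D x : set R := [set 1] `|` [set `|x - y| | y in ~` O].
have D_lb x : lbound (D x) 0 by move=> _ [->|[y _ <-]].
have D1 x : D x 1 by left.
have D_inf x : has_inf (D x) by split; [exists 1|exists 0].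
have ge0 x : 0 <= inf (D x) by apply: lb_le_inf; [exists 1|].
have lip x y : inf (D x) - inf (D y) <= `|x - y|.
  rewrite lerBlDr -lerBlDl; apply: lb_le_inf; first by exists 1.
  move=> _ [->|[w Ow <-]]; rewrite lerBlDl.
    apply: le_trans (ge_inf (D_inf x).2 (D1 x)) _.
    by rewrite lerDr.
  apply: (le_trans (ge_inf (D_inf x).2 _)); last exact: ler_distD y _ _.
  by right; exists w.
exists (fun x => inf (D x)); split=> // x.
  apply/cvgrPdist_lt => e e0; near=> y.
  apply: (@le_lt_trans _ _ `|x - y|).
    by rewrite ler_norml lip lerNl opprB distrC lip.
  by near: y; exact: cvgr_dist_lt.
split=> [lt0|Ox].
  apply: contrapT => nOx; move: lt0; rewrite ltNge => /negP; apply.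
  by apply: (ge_inf (D_inf x).2); right; exists x; rewrite ?subrr ?normr0.
have /nbhs_normP[e /= e0 sub] := open_nbhs_nbhs (conj openO Ox).
apply: (@lt_le_trans _ _ (Num.min 1 e)); first by rewrite lt_min ltr01.
apply: lb_le_inf; first by exists 1.
move=> _ [->|[w Ow <-]]; first by rewrite ge_min lexx.
by rewrite ge_min; apply/orP; right; rewrite leNgt; apply/negP => /sub.
Unshelve. all: by end_near. Qed.

(** Hall's condition holds: one, two or three of the functions have total mass [p], [2 * p] or
    [3 * p], exceeding 0, 1 and 2, while each index carries mass at most 1. The proof matches [b]
    and [c] first, then adds [a] along an augmenting path. *)
Lemma three_representatives (R : realFieldType) (I : finType) (a b c : I -> R) p :
    (forall i, 0 <= a i) -> (forall i, 0 <= b i) -> (forall i, 0 <= c i) ->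
    (forall i, a i + b i + c i <= 1) -> 2 < 3 * p ->
    \sum_i a i = p -> \sum_i b i = p -> \sum_i c i = p ->
  exists i j k, [/\ i != j, i != k & j != k] /\ [/\ 0 < a i, 0 < b j & 0 < c k].
Proof.
move=> a0 b0 c0 abc p0 sa sb sc.
have out (f : I -> R) (s : seq I) : uniq s -> (forall i, 0 <= f i) ->
    \sum_(i <- s) f i < \sum_i f i -> exists2 i, i \notin s & 0 < f i.
  move=> us f0; rewrite [ltRHS](bigID (mem s)) /= -big_uniq //= => lt.
  apply: contrapT => N; move: lt; rewrite [X in _ + X]big1 ?addr0 ?ltxx // => i si.
  by apply/eqP; apply: contra_notT N => fi; exists i; rewrite // lt0r fi f0.
pose f i := b i + c i.
have f0 i : 0 <= f i by rewrite addr_ge0.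
have sf : \sum_i f i = p + p by rewrite big_split /= sb sc.
have pair (g h : I -> R) : (forall i, 0 <= g i) -> (forall i, 0 <= h i) ->
    (forall i, g i + h i <= 1) -> \sum_i g i = p -> \sum_i h i = p ->
    exists i j, [/\ i != j, 0 < g i & 0 < h j].
  move=> g0 h0 gh sg sh.
  have [|i _ gi] := out g [::] isT g0; first by rewrite big_nil sg; lra.
  have [hi|hi] := ltP (\sum_(k <- [:: i]) h k) (\sum_k h k).
    have [//|j] := out h [:: i] isT h0.
    by rewrite inE eq_sym => ij hj; exists i, j.
  have [|j] := out g [:: i] isT g0.
    by move: hi (gh i); rewrite !big_seq1 sg sh; lra.
  rewrite inE => ji gj; exists j, i; split=> //.
  by move: hi; rewrite big_seq1 sh; lra.
have [j [k [jk bj ck]]] : exists j k, [/\ j != k, 0 < b j & 0 < c k].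
  by apply: pair => // i; have := abc i; have := a0 i; lra.
have ujk : uniq [:: j; k] by rewrite /= inE jk.
(* Either [a] has mass outside [j] and [k], or all its mass sits there. In the latter case some
   third index [i] has positive mass for one of the functions, and the matching is rearranged to use
   [i]. *)
have [ai|ai] := leP (\sum_i a i) (\sum_(i <- [:: j; k]) a i); last first.
  have [i] := out a _ ujk a0 ai.
  by rewrite !inE negb_or => /andP[ij ik] {}ai; exists i, j, k.
have [||i] := out (fun i => a i + b i + c i) _ ujk.
- by move=> i; rewrite !addr_ge0.
- rewrite !big_split /= sa sb sc !big_cons !big_nil.
  by have := abc j; have := abc k; lra.
rewrite !inE negb_or => /andP[ij ik] fi.
have {fi} : 0 < a i \/ 0 < b i \/ 0 < c i.
  by have := a0 i; have := b0 i; have := c0 i; lra.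
move=> [?|[bi|ci]]; first by exists i, j, k.
- have [aj|aj] := ltP 0 (a j).
    by exists j, i, k; split=> //; split=> //; rewrite eq_sym.
  have ak : 0 < a k by move: ai; rewrite !big_cons big_nil sa; have := a0 j; lra.
  have [|e] := out c [:: k] isT c0.
    have := abc k; have := b0 k; have := a0 j.
    by move: ai; rewrite !big_cons !big_nil sa sc; lra.
  rewrite inE => ek ce; have [ej|ej] := eqVneq e j.
    by exists k, i, j; split; split=> //; rewrite -?ej // eq_sym // ej.
  by exists k, j, e; split; split=> //; rewrite eq_sym.
have [ak|ak] := ltP 0 (a k).
  by exists k, j, i; split; split=> //; rewrite eq_sym.
have aj : 0 < a j by move: ai; rewrite !big_cons big_nil sa; have := a0 k; lra.
have [|e] := out b [:: j] isT b0.
  have := abc j; have := c0 j; have := a0 k.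
  by move: ai; rewrite !big_cons !big_nil sa sb; lra.
rewrite inE => ej be; have [ek|ek] := eqVneq e k.
  by exists j, k, i; split; split=> //; rewrite -?ek // eq_sym // ek.
by exists j, e, k; split; split=> //; rewrite eq_sym.
Qed.

(** * Poincare-Miranda applied to a partition of unity *)

Section Colorful.
Context (R : realType) (O : 'I_5 -> nat -> set 'rV[R]_4).
Hypothesis O_open : forall i j, open (O i j).
Hypothesis O_cover : forall i x, unit_cube R 4 x -> exists2 j, (j < 6)%N & O i j x.
Local Notation X x k := (x 0 (inord k)).
(** In [O00] to [O31] the first digit names a coordinate and the second its value on a face of the
    cube. Coordinates 0 and 1 encode the directions of the lines: on their faces two lines coincide
    and some sectors degenerate. Coordinates 2 and 3 encode the common point: on their faces it lies
    outside the box containing the sets. *)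
Hypothesis O00 : forall i x, unit_cube R 4 x -> X x 0 = 0 ->
  ~ O i 0 x /\ ~ O i 3 x.
Hypothesis O01 : forall i x, unit_cube R 4 x -> X x 0 = 1 ->
  ~ O i 1 x /\ ~ O i 4 x.
Hypothesis O10 : forall i x, unit_cube R 4 x -> X x 1 = 0 ->
  [/\ ~ O i 0 x, ~ O i 1 x, ~ O i 3 x & ~ O i 4 x].
Hypothesis O11 : forall i x, unit_cube R 4 x -> X x 1 = 1 ->
  ~ O i 2 x /\ ~ O i 5 x.
Hypothesis O20 : forall i i' x, unit_cube R 4 x -> X x 2 = 0 ->
  O i 2 x -> O i' 3 x -> False.
Hypothesis O21 : forall i i' x, unit_cube R 4 x -> X x 2 = 1 ->
  O i 0 x -> O i' 5 x -> False.
Hypothesis O30 : forall i x, unit_cube R 4 x -> X x 3 = 0 ->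
  [/\ ~ O i 3 x, ~ O i 4 x & ~ O i 5 x].
Hypothesis O31 : forall i x, unit_cube R 4 x -> X x 3 = 1 ->
  [/\ ~ O i 0 x, ~ O i 1 x & ~ O i 2 x].

Let psi i j := sval (cid (open_cozero R _ _ (O_open i j))).
Let psi_cont i j : continuous (psi i j).
Proof. by rewrite /psi; case: cid => ? []. Qed.
Let psi_ge0 i j x : 0 <= psi i j x.
Proof. by rewrite /psi; case: cid => ? []. Qed.
Let psi_gt0 i j x : 0 < psi i j x <-> O i j x.
Proof. by rewrite /psi; case: cid => ? []. Qed.

Let tot i x := \sum_(j < 6) psi i j x.
Let tot_gt0 i x : unit_cube R 4 x -> 0 < tot i x.
Proof.
move=> /(O_cover i)[j j6 /psi_gt0 Oj]; rewrite /tot (bigD1 (Ordinal j6)) //=.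
by rewrite ltr_wpDr // sumr_ge0.
Qed.

Let phi i j x := psi i j x / tot i x.
Let phi_ge0 i j x : 0 <= phi i j x.
Proof. by rewrite divr_ge0 // sumr_ge0. Qed.
Let phi_gt0 i j x : 0 < phi i j x -> O i j x.
Proof.
move=> h; apply/psi_gt0; rewrite lt0r psi_ge0 andbT; apply: contraTneq h.
by rewrite /phi => ->; rewrite mul0r ltxx.
Qed.
Let sum_phi i x : unit_cube R 4 x -> \sum_(j < 6) phi i j x = 1.
Proof. by move=> /(tot_gt0 i) h; rewrite -mulr_suml divff // gt_eqF. Qed.

Let f j x := \sum_i phi i j x.
Let f_ge0 j x : 0 <= f j x. Proof. exact: sumr_ge0. Qed.
Let f_eq0 j x : (forall i, ~ O i j x) -> f j x = 0.
Proof.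
move=> h; apply: big1 => i _; apply/eqP; rewrite eq_le phi_ge0 andbT leNgt.
by apply/negP => /phi_gt0 /h.
Qed.
Let f_gt0 j x : 0 < f j x -> exists i, O i j x.
Proof.
move=> h; apply: contrapT => N; move: h; rewrite f_eq0 ?ltxx // => i Oi.
by apply: N; exists i.
Qed.
Let sum_cvg (I : finType) (g : I -> 'rV[R]_4 -> R) x :
  (forall i, {for x, continuous (g i)}) ->
  {for x, continuous (fun y => \sum_i g i y)}.
Proof.
move=> gc; rewrite /prop_for /continuous_at.
by apply: cvg_big (nbhs_filter x) _ => [|i _]; [exact: add_continuous|exact: gc].
Qed.
Let f_cont j x : unit_cube R 4 x -> {for x, continuous (f j)}.
Proof.
move=> xc; apply: sum_cvg => i; apply: continuousM; first exact: psi_cont.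
apply: continuousV; first by rewrite gt_eqF // tot_gt0.
by apply: (sum_cvg _ (fun k : 'I_6 => psi i k)) => k; exact: psi_cont.
Qed.
Let sum_f x : unit_cube R 4 x ->
  f 0 x + f 1 x + f 2 x + f 3 x + f 4 x + f 5 x = 5.
Proof.
move=> xc; have : \sum_(j < 6) f j x = 5.
  rewrite exchange_big /=; under eq_bigr do rewrite sum_phi //.
  by rewrite sumr_const card_ord.
by move=> <-; rewrite !big_ord_recr big_ord0 /= add0r.
Qed.

(* At a common zero the first two components make [f 0 + f 3], [f 1 + f 4] and
[f 2 + f 5] equal; the third one is quadratic because on a vertical side of the
square only the products, and no linear combination, have a sign. *)
Let H (k : 'I_4) x := match val k with
  | 0 => (f 1 x + f 4 x) - (f 0 x + f 3 x)
  | 1 => 2 * (f 2 x + f 5 x) - (f 0 x + f 1 x + f 3 x + f 4 x)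
  | 2 => f 0 x * f 5 x - f 2 x * f 3 x
  | _ => (f 0 x + 2 * f 1 x + f 2 x) - (f 3 x + 2 * f 4 x + f 5 x)
  end.

Let prod_eq0 j k x : (forall i i', O i j x -> O i' k x -> False) ->
  f j x * f k x = 0.
Proof.
move=> h; have [fj|fj] := ltP 0 (f j x); last first.
  by rewrite (_ : f j x = 0) ?mul0r //; apply/eqP; rewrite eq_le fj f_ge0.
have [i Oi] := f_gt0 _ _ fj; rewrite (f_eq0 k) ?mulr0 // => i' /(h _ _ Oi).
exact.
Qed.

Let balanced : exists2 x, unit_cube R 4 x &
  [/\ f 0 x = f 2 x, f 2 x = f 4 x, f 1 x = f 3 x & f 3 x = f 5 x].
Proof.
have [i x xc|i x xc|i x xc|x xc Hx] := @poincare_miranda4 R H.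
- rewrite -[i]inord_val /H; case: i => -[|[|[|[|//]]]] /= _ xi; rewrite inordK //=.
  + have ge := f_ge0^~ x.
    have z0 : f 0 x = 0 by apply: f_eq0 => i; case: (O00 i x xc xi).
    have z3 : f 3 x = 0 by apply: f_eq0 => i; case: (O00 i x xc xi).
    rewrite z0 z3; have := ge 1; have := ge 2; have := ge 4; have := ge 5; lra.
  + have ge := f_ge0^~ x.
    have z0 : f 0 x = 0 by apply: f_eq0 => i; case: (O10 i x xc xi).
    have z1 : f 1 x = 0 by apply: f_eq0 => i; case: (O10 i x xc xi).
    have z3 : f 3 x = 0 by apply: f_eq0 => i; case: (O10 i x xc xi).
    have z4 : f 4 x = 0 by apply: f_eq0 => i; case: (O10 i x xc xi).
    rewrite z0 z1 z3 z4; have := ge 2; have := ge 5; lra.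
  + have ge := f_ge0^~ x.
    rewrite (prod_eq0 2 3) => [|i i']; last exact: O20.
    by rewrite subr0 mulr_ge0.
  + have ge := f_ge0^~ x.
    have z3 : f 3 x = 0 by apply: f_eq0 => i; case: (O30 i x xc xi).
    have z4 : f 4 x = 0 by apply: f_eq0 => i; case: (O30 i x xc xi).
    have z5 : f 5 x = 0 by apply: f_eq0 => i; case: (O30 i x xc xi).
    rewrite z3 z4 z5; have := ge 0; have := ge 1; have := ge 2; lra.
- rewrite -[i]inord_val /H; case: i => -[|[|[|[|//]]]] /= _ xi; rewrite inordK //=.
  + have ge := f_ge0^~ x.
    have z1 : f 1 x = 0 by apply: f_eq0 => i; case: (O01 i x xc xi).
    have z4 : f 4 x = 0 by apply: f_eq0 => i; case: (O01 i x xc xi).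
    rewrite z1 z4; have := ge 0; have := ge 2; have := ge 3; have := ge 5; lra.
  + have ge := f_ge0^~ x.
    have z2 : f 2 x = 0 by apply: f_eq0 => i; case: (O11 i x xc xi).
    have z5 : f 5 x = 0 by apply: f_eq0 => i; case: (O11 i x xc xi).
    rewrite z2 z5; have := ge 0; have := ge 1; have := ge 3; have := ge 4; lra.
  + have ge := f_ge0^~ x.
    rewrite (prod_eq0 0 5) => [|i i']; last exact: O21.
    by rewrite sub0r oppr_le0 mulr_ge0.
  + have ge := f_ge0^~ x.
    have z0 : f 0 x = 0 by apply: f_eq0 => i; case: (O31 i x xc xi).
    have z1 : f 1 x = 0 by apply: f_eq0 => i; case: (O31 i x xc xi).
    have z2 : f 2 x = 0 by apply: f_eq0 => i; case: (O31 i x xc xi).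
    rewrite z0 z1 z2; have := ge 3; have := ge 4; have := ge 5; lra.
- rewrite /H; case: i => -[|[|[|[|//]]]] /= _.
  + by apply: continuousB; apply: continuousD; exact: f_cont.
  + apply: continuousB; last by do !apply: continuousD; exact: f_cont.
    apply: continuousM; first exact: cst_continuous.
    by apply: continuousD; exact: f_cont.
  + by apply: continuousB; apply: continuousM; exact: f_cont.
  + have c2 k : {for x, continuous (fun y => 2 * f k y)}.
      by apply: continuousM; [exact: cst_continuous|exact: f_cont].
    by apply: continuousB; do !apply: continuousD; by [exact: f_cont|exact: c2].
exists x => //; have := sum_f x xc.
have := Hx (inord 0); have := Hx (inord 1); have := Hx (inord 2).
have := Hx (inord 3); rewrite /H /= !inordK //= => e3 e2 e1 e0 s.
set a := f 0 x in e0 e1 e2 e3 s *; set b := f 1 x in e0 e1 e2 e3 s *.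
set c := f 2 x in e0 e1 e2 e3 s *; set a' := f 3 x in e0 e1 e2 e3 s *.
set b' := f 4 x in e0 e1 e2 e3 s *; set c' := f 5 x in e0 e1 e2 e3 s *.
(* The first two components and the total 5 make each opposite pair sum to [5 / 3]. Substituting
   this turns the quadratic component into [a = c], and the last one then gives [a + b = 5 / 3]. *)
have a'E : a' = 5 / 3 - a by lra.
have c'E : c' = 5 / 3 - c by lra.
have {e2} : 5 / 3 * (a - c) = 0.
  by rewrite -[RHS]e2 a'E c'E; ring.
by move=> ?; split; lra.
Qed.

Lemma alternating_sectors : exists2 x, unit_cube R 4 x &
  exists i1 i2 i3, [/\ i1 != i2, i1 != i3 & i2 != i3] /\
    ([/\ O i1 0 x, O i2 2 x & O i3 4 x] \/ [/\ O i1 1 x, O i2 3 x & O i3 5 x]).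
Proof.
have [x xc [e02 e24 e13 e35]] := balanced; exists x => //; have s := sum_f x xc.
have row i : phi i 0 x + phi i 1 x + phi i 2 x + phi i 3 x + phi i 4 x
    + phi i 5 x = 1.
  by rewrite -(sum_phi i x xc) !big_ord_recr big_ord0 /= add0r.
have rep j1 j2 j3 : (forall i, phi i j1 x + phi i j2 x + phi i j3 x <= 1) ->
    f j1 x = f j2 x -> f j2 x = f j3 x -> 2 < 3 * f j3 x ->
    exists i1 i2 i3, [/\ i1 != i2, i1 != i3 & i2 != i3] /\
      [/\ O i1 j1 x, O i2 j2 x & O i3 j3 x].
  move=> le1 e1 e2 lt2.
  have [i1 [i2 [i3 [ne [h1 h2 h3]]]]] := three_representatives R _ _ _ _ _
    (fun i => phi_ge0 i j1 x) (fun i => phi_ge0 i j2 x)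
    (fun i => phi_ge0 i j3 x) le1 lt2 (etrans e1 e2) e2 erefl.
  by exists i1, i2, i3; split=> //; split; exact: phi_gt0.
(* [3 * f 4 x] and [3 * f 5 x] add up to 5, so one of them exceeds the threshold 2 of
   [three_representatives]. *)
have [lt|ge] := ltP 2 (3 * f 4 x).
  have le1 i : phi i 0 x + phi i 2 x + phi i 4 x <= 1.
    have := phi_ge0 i 1 x; have := phi_ge0 i 3 x; have := phi_ge0 i 5 x.
    by have := row i; lra.
  have [i1 [i2 [i3 [ne h]]]] := rep 0%N 2%N 4%N le1 e02 e24 lt.
  by exists i1, i2, i3; split=> //; left.
have le1 i : phi i 1 x + phi i 3 x + phi i 5 x <= 1.
  have := phi_ge0 i 0 x; have := phi_ge0 i 2 x; have := phi_ge0 i 4 x.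
  by have := row i; lra.
have [|i1 [i2 [i3 [ne h]]]] := rep 1%N 3%N 5%N le1 e13 e35; first by lra.
by exists i1, i2, i3; split=> //; right.
Qed.

End Colorful.

(** * Projective families of lines and compactness *)

(** [k_lines] asks for three distinct lines. When some of the [x k] coincide, the missing ones are
    filled in from an infinite supply [g] inside the same pencil [S]. *)
Lemma injective_cover (T : Type) (S : set T) (g : nat -> T) (x : 'I_3 -> T) :
    injective g -> (forall n, S (g n)) -> (forall k, S (x k)) ->
  exists L : 'I_3 -> T, [/\ injective L, forall j, S (L j) &
    forall k, exists j, L j = x k].
Proof.
move=> g_inj Sg Sx.
have fresh a b : exists c, [/\ S c, c <> a & c <> b].
  apply: contrapT => N.
  have h n : g n = a \/ g n = b.
    by apply: contrapT => /not_orP[na nb]; apply: N; exists (g n).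
  have ne i j c : g i = c -> g j = c -> i = j by move=> <- /g_inj.
  by case: (h 0%N) => E0; case: (h 1%N) => E1; case: (h 2%N) => E2;
    first [have := ne _ _ _ E0 E1 | have := ne _ _ _ E0 E2 | have := ne _ _ _ E1 E2].
pose x0 := x (inord 0); pose x1 := x (inord 1); pose x2 := x (inord 2).
have [y [Sy y0 y1]] : exists y, [/\ S y, y <> x0 & x1 = x0 \/ x1 = y].
  have [E|?] := pselect (x1 = x0); last by exists x1; split=> //; [exact: Sx|right].
  by have [c [Sc c0 _]] := fresh x0 x0; exists c; split=> //; left.
have [z [Sz z0 zy z2]] : exists z, [/\ S z, z <> x0, z <> y &
    x2 = x0 \/ x2 = y \/ x2 = z].
  have [E|?] := pselect (x2 = x0 \/ x2 = y); last first.
    by exists x2; split; [exact: Sx|tauto|tauto|tauto].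
  by have [c [Sc c0 cy]] := fresh x0 y; exists c; split=> //; tauto.
pose L (j : 'I_3) := if val j is 0 then x0 else if val j is 1 then y else z.
exists L; split.
- by move=> [[|[|[|//]]] ?] [[|[|[|//]]] ?]; rewrite /L /= => E;
    first [by apply: val_inj | case: (y0 E) | case: (y0 (esym E)) | case: (z0 E)
      | case: (z0 (esym E)) | case: (zy E) | case: (zy (esym E))].
- by move=> [[|[|[|//]]] ?]; rewrite /L //=; exact: Sx.
have L0 : L (inord 0) = x0 by rewrite /L /= inordK.
have L1 : L (inord 1) = y by rewrite /L /= inordK.
have L2 : L (inord 2) = z by rewrite /L /= inordK.
move=> k; rewrite -[k]inord_val; case: k => -[|[|[|//]]] /= _.
- by exists (inord 0).
- by case: y1 => E; [exists (inord 0)|exists (inord 1)]; rewrite ?L0 ?L1 -/x1.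
- by case: z2 => [E|[E|E]]; [exists (inord 0)|exists (inord 1)|exists (inord 2)];
    rewrite ?L0 ?L1 ?L2 -/x2.
Qed.

Section Plane.
Variable R : realType.
Implicit Types (p q d z : 'rV[R]_2) (l v : 'rV[R]_3).

Definition vec2 (a b : R) : 'rV[R]_2 := \row_i [:: a; b]`_i.

Lemma rV2P p q : p 0 0 = q 0 0 -> p 0 1 = q 0 1 -> p = q.
Proof.
move=> e0 e1; apply/rowP => -[[|[|//]] lt].
  by rewrite (_ : Ordinal lt = 0) //; apply: val_inj.
by rewrite (_ : Ordinal lt = 1) //; apply: val_inj.
Qed.

Lemma rV2_neq0 d : d != 0 -> d 0 0 ^+ 2 + d 0 1 ^+ 2 != 0.
Proof.
apply: contra_neq => /eqP; rewrite paddr_eq0 ?sqr_ge0 // !sqrf_eq0.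
by move=> /andP[/eqP d0 /eqP d1]; apply: rV2P; rewrite mxE.
Qed.

(* [l] holds the coefficients of a linear form on [R^3], that is, of a line of the
projective plane; [0, 0, 1] is the line at infinity. *)
Definition hom_eval l v : R := l 0 0 * v 0 0 + l 0 1 * v 0 1 + l 0 2 * v 0 2.

Definition aff_eval l z : R := l 0 0 * z 0 0 + l 0 1 * z 0 1 + l 0 2.

(** In the plane, [d] and [z - q] are both orthogonal to the nonzero vector [(a, b)], hence
    parallel. The parameter of [z] is the projection coefficient of [z - q] on [d]. *)
Lemma orthogonal_line (a b : R) q d z : d != 0 -> a ^+ 2 + b ^+ 2 != 0 ->
    a * d 0 0 + b * d 0 1 = 0 -> a * (z 0 0 - q 0 0) + b * (z 0 1 - q 0 1) = 0 ->
  line q d z.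
Proof.
move=> /rV2_neq0 d0 ab0 ad az.
have dz : d 0 0 * (z 0 1 - q 0 1) - d 0 1 * (z 0 0 - q 0 0) = 0.
  apply: (mulfI ab0); rewrite mulr0.
  set x := z 0 0 - q 0 0 in az *; set y := z 0 1 - q 0 1 in az *.
  transitivity ((a * y - b * x) * (a * d 0 0 + b * d 0 1)
     + (b * d 0 0 - a * d 0 1) * (a * x + b * y)); first by ring.
  by rewrite ad az; ring.
set D := _ + _ in d0 *.
set x := z 0 0 - q 0 0 in dz *; set y := z 0 1 - q 0 1 in dz *.
exists ((x * d 0 0 + y * d 0 1) / D) => //; apply: rV2P; rewrite !mxE mulrAC.
  have -> : (x * d 0 0 + y * d 0 1) * d 0 0 = x * D.
    transitivity (x * D + d 0 1 * (d 0 0 * y - d 0 1 * x)); rewrite /D; first by ring.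
    by rewrite dz mulr0 addr0.
  by rewrite mulfK // addrC subrK.
have -> : (x * d 0 0 + y * d 0 1) * d 0 1 = y * D.
  transitivity (y * D - d 0 0 * (d 0 0 * y - d 0 1 * x)); rewrite /D; first by ring.
  by rewrite dz mulr0 subr0.
by rewrite mulfK // addrC subrK.
Qed.

(** The common projective point [v] is either at infinity, and the affine lines are parallel to
    [(v 0 0, v 0 1)], or it is the affine point obtained by dividing by [v 0 2]. [injective_cover]
    makes the three lines distinct within that pencil. *)
Lemma concurrent_cover v (l : 'I_3 -> 'rV[R]_3) : v != 0 ->
    (forall k, l k != 0) -> (forall k, hom_eval (l k) v = 0) ->
  exists L : 'I_3 -> set 'rV[R]_2, [/\ k_lines L,
    concurrent L \/ all_parallel L &
    forall k z, aff_eval (l k) z = 0 -> exists j, L j z].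
Proof.
have rV3P (u : 'rV[R]_3) : u 0 0 = 0 -> u 0 1 = 0 -> u 0 2 = 0 -> u = 0.
  move=> e0 e1 e2; apply/rowP => -[[|[|[|//]]] lt]; rewrite mxE.
  - by rewrite (_ : Ordinal lt = 0) //; apply: val_inj.
  - by rewrite (_ : Ordinal lt = 1) //; apply: val_inj.
  - by rewrite (_ : Ordinal lt = 2) //; apply: val_inj.
move=> v0 l0 lv; have [m0|m0] := eqVneq (v 0 2) 0.
  pose e := vec2 (v 0 0) (v 0 1).
  have e0 : e != 0.
    apply: contraNneq v0 => e0; apply/eqP; apply: rV3P => //.
      by have := congr1 (fun u : 'rV_2 => u 0 0) e0; rewrite !mxE.
    by have := congr1 (fun u : 'rV_2 => u 0 1) e0; rewrite !mxE.
  pose g n := line (n%:R *: vec2 (- e 0 1) (e 0 0)) e.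
  have g_inj : injective g.
    move=> i j gij.
    have : g i (i%:R *: vec2 (- e 0 1) (e 0 0)).
      by exists 0; rewrite // scale0r addr0.
    rewrite gij => -[t _ E].
    have E0 := congr1 (fun u : 'rV_2 => u 0 0) E.
    have E1 := congr1 (fun u : 'rV_2 => u 0 1) E.
    rewrite !mxE /= in E0 E1.
    have : (j%:R - i%:R) * (e 0 0 ^+ 2 + e 0 1 ^+ 2) = 0.
      have := congr1 (fun r => r * v 0 1) E0; have := congr1 (fun r => r * v 0 0) E1.
      by rewrite !mxE /=; lra.
    move/eqP; rewrite mulf_eq0 (negPf (rV2_neq0 _ e0)) orbF subr_eq0 eqr_nat.
    by move/eqP.
  have /choice[x Hx] k : exists x, (exists q, x = line q e) /\
      forall z, aff_eval (l k) z = 0 -> x z.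
    have [[q lq]|N] := pselect (exists q, aff_eval (l k) q = 0); last first.
      (* Here [l k] is the line at infinity, and any line of the pencil can stand in for it. *)
      by exists (line 0 e); split; [exists 0|move=> z lz; case: N; exists z].
    exists (line q e); split=> [|z lz]; first by exists q.
    apply: (@orthogonal_line (l k 0 0) (l k 0 1)) => //.
    - apply: contraNneq (l0 k) => /eqP.
      rewrite paddr_eq0 ?sqr_ge0 // !sqrf_eq0 => /andP[/eqP l00 /eqP l01].
      by apply/eqP/rV3P => //; move: lq; rewrite /aff_eval l00 l01 !mul0r !add0r.
    - have := lv k; rewrite /hom_eval m0 mulr0 addr0.
      by rewrite !mxE.
    - by move: lz lq; rewrite /aff_eval; lra.
  have [|k|k|L [Linj LS Lx]] := @injective_cover _ [set x | exists q, x = line q e] g x.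
  - exact: g_inj.
  - by exists (k%:R *: vec2 (- e 0 1) (e 0 0)).
  - by case: (Hx k).
  exists L; split.
  - by split=> // j; have [q ->] := LS j; exists q, e.
  - by right; exists e => // j; have [q ->] := LS j; exists q.
  - by move=> k z lz; have [j Lj] := Lx k; exists j; rewrite Lj; apply: (Hx k).2.
pose p := vec2 (v 0 0 / v 0 2) (v 0 1 / v 0 2).
pose g n := line p (vec2 1 n%:R).
have g_inj : injective g.
  move=> i j gij.
  have : g i (p + vec2 1 i%:R) by exists 1; rewrite // scale1r.
  rewrite gij => -[t _ /addrI E].
  have E0 := congr1 (fun u : 'rV_2 => u 0 0) E.
  have E1 := congr1 (fun u : 'rV_2 => u 0 1) E.
  rewrite !mxE /= mulr1 in E0; rewrite !mxE /= E0 mul1r in E1.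
  by move/eqP: E1; rewrite eqr_nat => /eqP.
have /choice[x Hx] k : exists x, (exists2 d, d != 0 & x = line p d) /\
    forall z, aff_eval (l k) z = 0 -> x z.
  have lp : aff_eval (l k) p = 0.
    have := lv k; rewrite /hom_eval /aff_eval !mxE /= => h.
    apply: (mulIf m0); rewrite mul0r -[RHS]h; field.
    exact: m0.
  pose d := vec2 (- l k 0 1) (l k 0 0).
  have d0 : d != 0.
    apply: contraNneq (l0 k) => d0; apply/eqP.
    have l00 : l k 0 0 = 0.
      by have := congr1 (fun u : 'rV_2 => u 0 1) d0; rewrite !mxE.
    have l01 : l k 0 1 = 0.
      by have /eqP := congr1 (fun u : 'rV_2 => u 0 0) d0; rewrite !mxE oppr_eq0 => /eqP.
    by apply: rV3P => //; move: lp; rewrite /aff_eval l00 l01 !mul0r !add0r.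
  exists (line p d); split=> [|z lz]; first by exists d.
  apply: (@orthogonal_line (l k 0 0) (l k 0 1)) => //.
  - by have := rV2_neq0 _ d0; rewrite !mxE /= sqrrN addrC.
  - by rewrite !mxE /=; ring.
  - by move: lz lp; rewrite /aff_eval; lra.
have [|k|k|L [Linj LS Lx]] :=
  @injective_cover _ [set x | exists2 d, d != 0 & x = line p d] g x.
- exact: g_inj.
- exists (vec2 1 k%:R) => //; apply/eqP => /(congr1 (fun u : 'rV_2 => u 0 0)).
  by rewrite !mxE /=; apply/eqP; rewrite oner_eq0.
- by case: (Hx k).
exists L; split.
- by split=> // j; have [d d0 ->] := LS j; exists p, d.
- by left; exists p => j; have [d d0 ->] := LS j; exists 0; rewrite // scale0r addr0.
- by move=> k z lz; have [j Lj] := Lx k; exists j; rewrite Lj; apply: (Hx k).2.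
Qed.

End Plane.

(** * Compactness of triples of concurrent projective lines *)

Section Compactness.
Variable R : realType.
Implicit Types (T : topologicalType).

Lemma continuous_fst (T U V : topologicalType) (g : T -> U * V) t :
  {for t, continuous g} -> {for t, continuous (fun s => (g s).1)}.
Proof. by move=> gc; apply: (continuous_comp gc); exact: cvg_fst. Qed.

Lemma continuous_snd (T U V : topologicalType) (g : T -> U * V) t :
  {for t, continuous g} -> {for t, continuous (fun s => (g s).2)}.
Proof. by move=> gc; apply: (continuous_comp gc); exact: cvg_snd. Qed.

Lemma entry_continuous T n (g : T -> 'rV[R]_n) i t :
  {for t, continuous g} -> {for t, continuous (fun s => g s 0 i : R)}.
Proof.
move=> gc; apply: (@continuous_comp _ _ _ g (fun u : 'rV[R]_n => u 0 i)) => //.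
exact: coord_continuous.
Qed.

Lemma hom_eval_continuous T (g h : T -> 'rV[R]_3) t :
  {for t, continuous g} -> {for t, continuous h} ->
  {for t, continuous (fun s => hom_eval R (g s) (h s))}.
Proof.
move=> gc hc; do 2?[apply: continuousD]; apply: continuousM;
  exact: entry_continuous.
Qed.

Lemma aff_eval_continuous T (g : T -> 'rV[R]_3) (h : T -> 'rV[R]_2) t :
  {for t, continuous g} -> {for t, continuous h} ->
  {for t, continuous (fun s => aff_eval R (g s) (h s))}.
Proof.
move=> gc hc; apply: continuousD; last exact: entry_continuous.
by apply: continuousD; apply: continuousM; exact: entry_continuous.
Qed.

Lemma unit_sphere_compact n : compact [set v : 'rV[R]_n | `|v| = 1].
Proof.
apply: bounded_closed_compact.
  by exists 1; split=> // M M1 v /= ->; exact: ltW.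
apply: (@closed_comp _ _ (fun v : 'rV[R]_n => `|v|) [set x | x = 1]).
  by move=> v _; exact: norm_continuous.
exact: closed_eq.
Qed.

Definition in_box (N : R) (A : set 'rV[R]_2) := forall z, A z -> forall i, `|z 0 i| <= N.

Definition misses (l : 'rV[R]_3) (A : set 'rV[R]_2) :=
  forall z, A z -> aff_eval R l z != 0.

Local Notation W := ('rV[R]_3 * ('rV[R]_3 * ('rV[R]_3 * 'rV[R]_3)))%type.

(** After scaling, the data range over a product of unit spheres. Near a concurrent triple,
    [concurrent_cover] and the failure of piercing give one compact [A] avoiding the three lines;
    the same [A], in a fixed box, serves all nearby triples. Compactness leaves a single box
    size. *)
Lemma unpierced_bounded (F : set (set 'rV[R]_2)) :
    (forall A, F A -> compact A) ->
    (forall L : 'I_3 -> set 'rV[R]_2, k_lines L ->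
      concurrent L \/ all_parallel L -> ~ pierces L F) ->
  \forall n \near \oo, forall v l0 l1 l2 : 'rV[R]_3,
    v != 0 -> l0 != 0 -> l1 != 0 -> l2 != 0 ->
    hom_eval R l0 v = 0 -> hom_eval R l1 v = 0 -> hom_eval R l2 v = 0 ->
    exists A, [/\ F A, in_box n%:R A & [/\ misses l0 A, misses l1 A & misses l2 A]].
Proof.
move=> Fc Fp; pose S := [set v : 'rV[R]_3 | `|v| = 1].
have Sc : compact S by exact: unit_sphere_compact.
pose good (n : nat) (w : W) :=
  hom_eval R w.2.1 w.1 = 0 -> hom_eval R w.2.2.1 w.1 = 0 ->
  hom_eval R w.2.2.2 w.1 = 0 -> exists A, [/\ F A, in_box n%:R A &
    [/\ misses w.2.1 A, misses w.2.2.1 A & misses w.2.2.2 A]].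
have SSc := compact_setX Sc (compact_setX Sc (compact_setX Sc Sc)).
have /(compact_near_coveringP _).1 /(_ nat \oo good) := SSc.
case=> [w [/= Sv [Sl0 [Sl1 Sl2]]]|N _ Ngood]; last first.
  exists N => // n /Ngood {}Ngood v l0 l1 l2 v0 l00 l10 l20 e0 e1 e2.
  pose nm (u : 'rV[R]_3) := `|u|^-1 *: u.
  have nmS u : u != 0 -> S (nm u).
    by move=> u0; rewrite /S /= /nm normrZ normfV normr_id mulVf // normr_eq0.
  have nmh l v' : hom_eval R l v' = 0 -> hom_eval R (nm l) (nm v') = 0.
    move=> e; transitivity (`|l|^-1 * `|v'|^-1 * hom_eval R l v').
      by rewrite /hom_eval !mxE; ring.
    by rewrite e mulr0.
  have nmm l A : misses (nm l) A -> misses l A.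
    move=> m z /m; apply: contra_neq => e.
    transitivity (`|l|^-1 * aff_eval R l z); last by rewrite e mulr0.
    by rewrite /aff_eval !mxE; ring.
  have := Ngood (nm v, (nm l0, (nm l1, nm l2))).
  case; do ?[by do !split; exact: nmS]; try exact: nmh.
  by move=> A [FA bA [m0 m1 m2]]; exists A; split=> //; split; exact: nmm.
have S0 u : S u -> u != 0 by apply: contraPneq => ->; rewrite /S /= normr0; lra.
have ci : {for w, continuous (@id W)} by exact: cvg_id.
have cv := continuous_fst _ _ _ _ _ ci; have ct := continuous_snd _ _ _ _ _ ci.
have c0 := continuous_fst _ _ _ _ _ ct; have c' := continuous_snd _ _ _ _ _ ct.
have c1 := continuous_fst _ _ _ _ _ c'; have c2 := continuous_snd _ _ _ _ _ c'.
(* Where an incidence fails, it fails in a whole neighbourhood, and [good] holds there vacuously. *)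
have off (g h : W -> 'rV[R]_3) : {for w, continuous g} -> {for w, continuous h} ->
    hom_eval R (g w) (h w) != 0 ->
    \forall w' \near w & n \near \oo, hom_eval R (g w') (h w') <> 0.
  move=> gc hc /(cvgr_neq0 _ (hom_eval_continuous _ _ _ _ gc hc)) gh.
  exists ([set w' | hom_eval R (g w') (h w') != 0], setT).
    by split; [exact: gh|exact: filterT].
  by move=> [w' n] [/= /eqP].
have [e0|/(off _ _ c0 cv)] := eqVneq (hom_eval R w.2.1 w.1) 0; last first.
  by apply: filterS => -[w' n] /= ne /ne.
have [e1|/(off _ _ c1 cv)] := eqVneq (hom_eval R w.2.2.1 w.1) 0; last first.
  by apply: filterS => -[w' n] /= ne _ /ne.
have [e2|/(off _ _ c2 cv)] := eqVneq (hom_eval R w.2.2.2 w.1) 0; last first.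
  by apply: filterS => -[w' n] /= ne _ _ /ne.
have [A [FA m0 m1 m2]] : exists A, [/\ F A, misses w.2.1 A,
    misses w.2.2.1 A & misses w.2.2.2 A].
  apply: contrapT => N.
  pose l (k : 'I_3) := nth 0 [:: w.2.1; w.2.2.1; w.2.2.2] k.
  have [|||L [Lk Lc Lz]] := @concurrent_cover R w.1 l; first exact: S0.
  - by move=> [[|[|[|//]]] ?]; rewrite /l /=; apply: S0.
  - by move=> [[|[|[|//]]] ?]; rewrite /l /=.
  apply: (Fp L) => // A FA.
  have [k [z [Az lz]]] : exists k z, A z /\ aff_eval R (l k) z = 0.
    apply: contrapT => N'; apply: N; exists A; split=> // z Az; apply/eqP => e;
    apply: N'.
    - by exists (inord 0), z; rewrite /l inordK.
    - by exists (inord 1), z; rewrite /l inordK.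
    - by exists (inord 2), z; rewrite /l inordK.
  by have [j Lj] := Lz k z lz; exists z; split=> //; exists j.
(* Nonvanishing is open in the point and the line jointly; compactness of [A] makes it uniform over
   [A]. *)
have near_miss (g : W -> 'rV[R]_3) : {for w, continuous g} -> misses (g w) A ->
    \forall w' \near w, misses (g w') A.
  move=> gc gA; have /(compact_near_coveringP _).1 := Fc A FA.
  move=> /(_ _ (nbhs w) (fun w' z => aff_eval R (g w') z != 0)).
  apply=> z Az.
  have c : {for (z, w), continuous (fun q : 'rV[R]_2 * W => aff_eval R (g q.2) q.1)}.
    apply: aff_eval_continuous; last exact: cvg_fst.
    by apply: (continuous_comp (g := g)); [exact: cvg_snd|exact: gc].
  exact: (cvgr_neq0 _ c (gA z Az)).
have [M M0 AM] : exists2 M : R, 0 <= M & in_box M A.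
  have [M [_ AM]] := compact_bounded (Fc A FA).
  exists (`|M| + 1); first by rewrite addr_ge0.
  move=> z Az i; apply: le_trans (AM (`|M| + 1) _ z Az); last first.
    by rewrite (le_lt_trans (ler_norm M)) // ltrDl.
  rewrite [leRHS]/Num.norm /= mx_normrE.
  exact: (le_bigmax _ (fun i => `|z i.1 i.2|) (0, i)).
exists ([set w' : W | [/\ misses w'.2.1 A, misses w'.2.2.1 A &
    misses w'.2.2.2 A]], [set n | M <= n%:R]).
  split; last exact: nbhs_infty_ger.
  by near=> w'; split; near: w'; exact: near_miss.
move=> [w' n] [/= ms Mn] _ _ _; exists A; split=> // z Az i.
exact: le_trans (AM z Az i) Mn.
Unshelve. all: by end_near. Qed.

End Compactness.

(** * The six sectors of three concurrent lines *)

Section Sectors.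
Variables (R : realType) (M : R).
Implicit Types (x : 'rV[R]_4) (z p : 'rV[R]_2) (l : 'rV[R]_3).
Local Notation X x k := (x 0 (inord k)).

(* The line through [p] with direction [(1 - 2 u, u (1 - u))], which turns from
[(1, 0)] to [(-1, 0)] through the upper half plane as [u] goes from 0 to 1. *)
Definition line_form (u : R) p : 'rV[R]_3 :=
  \row_i [:: - (u * (1 - u)); 1 - 2 * u; u * (1 - u) * p 0 0 - (1 - 2 * u) * p 0 1]`_i.

(* The square parametrizes the triangle [0 <= slope x 1 <= slope x 2 <= 1]. *)
Definition slope x k : R := [:: 0; X x 0 * X x 1; X x 1]`_k.

Definition apex x : 'rV[R]_2 := vec2 R (M * (2 * X x 2 - 1)) (M * (2 * X x 3 - 1)).

Definition side x k z := aff_eval R (line_form (slope x k) (apex x)) z.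

(* The sectors are numbered counterclockwise, starting at the ray from the apex
with direction [(1, 0)]. *)
Definition sector x j : set 'rV[R]_2 := [set z | forall k, (k < 3)%N ->
  0 < if (k <= j < k + 3)%N then side x k z else - side x k z].

Lemma sideE x k z : let u := slope x k in
  side x k z = (1 - 2 * u) * (z 0 1 - M * (2 * X x 3 - 1))
    - u * (1 - u) * (z 0 0 - M * (2 * X x 2 - 1)).
Proof. by rewrite /side /aff_eval !mxE /=; ring. Qed.

Lemma line_form_neq0 u p : line_form u p != 0.
Proof.
apply/eqP => e; have := congr1 (fun v : 'rV_3 => v 0 0) e.
have := congr1 (fun v : 'rV_3 => v 0 1) e; rewrite !mxE /= => {e} e1.
have -> : u = 2^-1 by lra.
by move=> ?; lra.
Qed.

Lemma hom_eval_line_form u p :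
  hom_eval R (line_form u p) (\row_i [:: p 0 0; p 0 1; 1]`_i) = 0.
Proof. by rewrite /hom_eval !mxE /=; ring. Qed.

Local Notation W := ('rV[R]_2 * 'rV[R]_4)%type.

Lemma side_continuous k (w : W) :
  {for w, continuous (fun q : W => side q.2 k q.1)}.
Proof.
have ci : {for w, continuous (@id W)} by exact: cvg_id.
have cc (c : R) : {for w, continuous (fun _ : W => c)}.
  exact: cst_continuous.
have cz i := entry_continuous _ _ _ _ i _ (continuous_fst _ _ _ _ _ ci).
have cx i := entry_continuous _ _ _ _ i _ (continuous_snd _ _ _ _ _ ci).
have cu : {for w, continuous (fun q : W => slope q.2 k)}.
  rewrite /slope; case: k => [|[|[|k]]] /=; [exact: cc| |exact: cx|].
    by apply: continuousM; exact: cx.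
  by case: k => [|k]; exact: cc.
have -> : (fun q : W => side q.2 k q.1) = (fun q : W =>
    (1 - 2 * slope q.2 k) * (q.1 0 1 - M * (2 * X q.2 3 - 1))
    - slope q.2 k * (1 - slope q.2 k) * (q.1 0 0 - M * (2 * X q.2 2 - 1))).
  by apply/funext => q; exact: sideE.
have cp i : {for w, continuous (fun q : W => M * (2 * q.2 0 i - 1))}.
  apply: continuousM; first exact: cc.
  by apply: continuousB; [apply: continuousM|]; try exact: cc; exact: cx.
apply: continuousB; apply: continuousM.
- by apply: continuousB; [|apply: continuousM]; try exact: cc; exact: cu.
- by apply: continuousB; [exact: cz|exact: cp].
- by apply: continuousM; [|apply: continuousB]; try exact: cc; exact: cu.
- by apply: continuousB; [exact: cz|exact: cp].
Qed.

(** This is what makes the sets of the cover open: the sector inequalities are strict and jointly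
    continuous, hence stable uniformly over a compact set. *)
Lemma near_sector x j A : compact A -> A `<=` sector x j ->
  \forall x' \near x, A `<=` sector x' j.
Proof.
move=> /(compact_near_coveringP _).1 cA As.
have near_k k : (k < 3)%N -> \forall x' \near x, forall z, A z ->
    0 < if (k <= j < k + 3)%N then side x' k z else - side x' k z.
  move=> k3; apply: (cA _ (nbhs x)
    (fun x' z => 0 < if (k <= j < k + 3)%N then side x' k z else - side x' k z)).
  move=> z Az; have := As z Az k k3.
  have sc := side_continuous k (z, x).
  case: ifP => _ s0; first exact: (cvgr_gt _ sc _ s0).
  exact: (cvgr_gt _ (continuousN sc) _ s0).
near=> x' => z Az k.
move: k => [|[|[|//]]] _; move: z Az; near: x'; exact: near_k.
Unshelve. all: by end_near. Qed.

Lemma connected_sign (A : set 'rV[R]_2) l : connected A -> misses R l A ->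
  (forall z, A z -> 0 < aff_eval R l z) \/ (forall z, A z -> aff_eval R l z < 0).
Proof.
move=> cA mA; apply: contrapT => /not_orP[].
move=> /existsNP[z1 /not_implyP[A1 /negP]]; rewrite -leNgt => n1.
move=> /existsNP[z2 /not_implyP[A2 /negP]]; rewrite -leNgt => n2.
have : connected (aff_eval R l @` A).
  apply: connected_continuous_connected => //; apply: continuous_subspaceT => z.
  apply: aff_eval_continuous; [exact: cst_continuous|exact: cvg_id].
move/connected_intervalP/(_ (aff_eval R l z1) (aff_eval R l z2)).
case/(_ _ _ 0); [by exists z1|by exists z2|by rewrite n1 n2|].
by move=> z Az e; have := mA z Az; rewrite e eqxx.
Qed.

(** By connectedness [A] lies on one side of each line, which leaves eight sign patterns. Six are
    the sectors; the patterns [+ - +] and [- + -] cannot occur because the three directions come in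
    counterclockwise order within a half turn. *)
Lemma sector_cover x A : unit_cube R 4 x -> connected A -> A !=set0 ->
    (forall k, (k < 3)%N -> misses R (line_form (slope x k) (apex x)) A) ->
  exists2 j, (j < 6)%N & A `<=` sector x j.
Proof.
move=> xc cA [z0 Az0] mA.
have s0 := connected_sign A _ cA (mA 0%N isT).
have s1 := connected_sign A _ cA (mA 1%N isT).
have s2 := connected_sign A _ cA (mA 2%N isT).
rewrite -/(side x 0 _) in s0; rewrite -/(side x 1 _) in s1; rewrite -/(side x 2 _) in s2.
have impossible : ~ (0 < side x 0 z0 /\ side x 1 z0 < 0 /\ 0 < side x 2 z0) /\
    ~ (side x 0 z0 < 0 /\ 0 < side x 1 z0 /\ side x 2 z0 < 0).
  have /andP[S0 S1] := xc (inord 0); have /andP[T0 T1] := xc (inord 1).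
  rewrite !sideE /slope /=.
  set s := X x 0 in S0 S1 *; set t := X x 1 in T0 T1 *.
  set Z := z0 0 1 - _; set W := z0 0 0 - _.
  rewrite !(mulr0, mul0r, subr0, mul1r).
  set u := s * t; have u0 : 0 <= u by rewrite mulr_ge0.
  have ut : u <= t by rewrite ler_piMl.
  set b := (1 - 2 * u) * _ - _; set c := (1 - 2 * t) * _ - _.
  (* With [d0], [d1], [d2] the three directions, [rel] is the linear relation
  [det(d1,d2) Z + det(d0,d1) c = det(d0,d2) b], with nonnegative coefficients. *)
  pose P := (t - u) * ((1 - u) * (1 - t) + u * t).
  have P0 : 0 <= P by rewrite mulr_ge0 ?subr_ge0 // addr_ge0 ?mulr_ge0 //; lra.
  have U0 : 0 <= u * (1 - u) by rewrite mulr_ge0 //; lra.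
  have V0 : 0 <= t * (1 - t) by rewrite mulr_ge0 //; lra.
  have rel : P * Z + u * (1 - u) * c = t * (1 - t) * b by rewrite /P /b /c; ring.
  have noV : t * (1 - t) = 0 ->
      (0 < Z -> 0 < c -> 0 <= b) /\ (Z < 0 -> c < 0 -> b <= 0).
    move/eqP; rewrite mulf_eq0 => /orP[/eqP t0|/eqP t1].
      have -> : b = Z by rewrite /b (_ : u = 0) ?/u ?t0; ring.
      by split=> *; exact: ltW.
    have cZ : c = - Z by rewrite /c (_ : t = 1); [ring|lra].
    by rewrite cZ; split=> *; lra.
  split=> -[Zs [bs cs]].
    have := mulr_ge0 P0 (ltW Zs); have := mulr_ge0 U0 (ltW cs) => h1 h2.
    have [V|V] := eqVneq (t * (1 - t)) 0; first by have := (noV V).1 Zs cs; lra.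
    have := @pmulr_rlt0 _ (t * (1 - t)) b; rewrite lt0r V V0 bs => /(_ isT); lra.
  have := mulr_ge0_le0 P0 (ltW Zs); have := mulr_ge0_le0 U0 (ltW cs) => h1 h2.
  have [V|V] := eqVneq (t * (1 - t)) 0; first by have := (noV V).2 Zs cs; lra.
  have := @pmulr_rgt0 _ (t * (1 - t)) b; rewrite lt0r V V0 bs => /(_ isT); lra.
have go j : (j < 6)%N -> (forall z, A z -> sector x j z) ->
  exists2 j, (j < 6)%N & A `<=` sector x j by exists j.
case: s0 s1 s2 impossible => [a|a] [b|b] [c|c] [N1 N2].
- apply: (go 2%N) => // z Az [|[|[|//]]] _ /=; [exact: a|exact: b|exact: c].
- apply: (go 1%N) => // z Az [|[|[|//]]] _ /=; rewrite ?oppr_gt0;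
    [exact: a|exact: b|exact: c].
- by case: N1; split; [exact: a|split; [exact: b|exact: c]].
- apply: (go 0%N) => // z Az [|[|[|//]]] _ /=; rewrite ?oppr_gt0;
    [exact: a|exact: b|exact: c].
- apply: (go 3%N) => // z Az [|[|[|//]]] _ /=; rewrite ?oppr_gt0;
    [exact: a|exact: b|exact: c].
- by case: N2; split; [exact: a|split; [exact: b|exact: c]].
- apply: (go 4%N) => // z Az [|[|[|//]]] _ /=; rewrite ?oppr_gt0;
    [exact: a|exact: b|exact: c].
- apply: (go 5%N) => // z Az [|[|[|//]]] _ /=; rewrite ?oppr_gt0;
    [exact: a|exact: b|exact: c].
Qed.

End Sectors.

(** * No line meets three alternate sectors *)

Section Transversal.
Variable R : realType.

Lemma affine_between (a b r s t : R) : r <= s <= t \/ t <= s <= r ->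
  0 < a + b * r -> 0 < a + b * t -> 0 < a + b * s.
Proof.
move=> h hr ht; have [rt|rt] := eqVneq r t.
  by have -> : s = r; [move: h rt; lra|].
have [b0|b0] := leP 0 b; case: h => /andP[h1 h2].
- by apply: lt_le_trans hr _; rewrite lerD2l ler_wpM2l.
- by apply: lt_le_trans ht _; rewrite lerD2l ler_wpM2l.
- by apply: lt_le_trans ht _; rewrite lerD2l ler_wnM2l // ltW.
- by apply: lt_le_trans hr _; rewrite lerD2l ler_wnM2l // ltW.
Qed.

(** One of three collinear points lies between the other two. Each point is singled out by a form
    with the opposite sign at the other two ([c] for [z1], [b] for [z2], [a] for [z3]), which is
    impossible for the middle one. *)
Lemma no_common_line (l : set 'rV[R]_2) (a b c : 'rV[R]_3) (z1 z2 z3 : 'rV[R]_2) :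
    is_line l -> l z1 -> l z2 -> l z3 ->
    [/\ 0 < aff_eval R a z1, 0 < aff_eval R a z2 & aff_eval R a z3 < 0] ->
    [/\ aff_eval R b z1 < 0, 0 < aff_eval R b z2 & aff_eval R b z3 < 0] ->
    [/\ aff_eval R c z1 < 0, 0 < aff_eval R c z2 & 0 < aff_eval R c z3] -> False.
Proof.
move=> [p [d [_ ->]]] [t1 _ <-] [t2 _ <-] [t3 _ <-].
have E (f : 'rV[R]_3) t : aff_eval R f (p + t *: d) =
    aff_eval R f p + (f 0 0 * d 0 0 + f 0 1 * d 0 1) * t.
  by rewrite /aff_eval !mxE; ring.
rewrite !E => -[a1 a2 a3] [b1 b2 b3] [c1 c2 c3].
have H (u v r s t : R) : r <= s <= t \/ t <= s <= r ->
    (0 < u + v * r -> 0 < u + v * t -> u + v * s < 0 -> False) /\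
    (u + v * r < 0 -> u + v * t < 0 -> 0 < u + v * s -> False).
  move=> h; split=> hr ht hs; have := affine_between _ _ _ _ _ h.
    by move=> /(_ u v hr ht); lra.
  by move=> /(_ (- u) (- v)); rewrite !mulNr -!opprD !oppr_gt0 => /(_ hr ht); lra.
have [h|[h|h]] : (t1 <= t2 <= t3 \/ t3 <= t2 <= t1) \/
    (t2 <= t1 <= t3 \/ t3 <= t1 <= t2) \/ (t1 <= t3 <= t2 \/ t2 <= t3 <= t1) by lra.
- exact: (H _ _ _ _ _ h).2 b1 b3 b2.
- exact: (H _ _ _ _ _ h).1 c2 c3 c1.
- exact: (H _ _ _ _ _ h).1 a1 a2 a3.
Qed.

Lemma alternating_sectors_no_line (M : R) x l (z1 z2 z3 : 'rV[R]_2) j :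
    is_line l -> l z1 -> l z2 -> l z3 -> (j < 2)%N ->
  sector R M x j z1 -> sector R M x (j + 2) z2 -> sector R M x (j + 4) z3 -> False.
Proof.
move=> ll l1 l2 l3 j2 s1 s2 s3.
have := s1 0%N isT; have := s1 1%N isT; have := s1 2%N isT.
have := s2 0%N isT; have := s2 1%N isT; have := s2 2%N isT.
have := s3 0%N isT; have := s3 1%N isT; have := s3 2%N isT.
case: j j2 {s1 s2 s3} => [|[|//]] _ /=; rewrite ?oppr_gt0 => ? ? ? ? ? ? ? ? ?.
  by apply: (no_common_line l (line_form R (slope R x 0) (apex R M x))
    (line_form R (slope R x 1) (apex R M x))
    (line_form R (slope R x 2) (apex R M x)) z1 z2 z3).
have N f z : aff_eval R (- f) z = - aff_eval R f z.
  by rewrite /aff_eval !mxE; ring.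
apply: (no_common_line l (line_form R (slope R x 1) (apex R M x))
    (line_form R (slope R x 2) (apex R M x))
    (- line_form R (slope R x 0) (apex R M x)) z1 z2 z3) => //.
by rewrite !N !oppr_gt0 oppr_lt0.
Qed.

End Transversal.

(** * Sectors on the faces of the configuration cube *)

Section Boundary.
Variables (R : realType) (N : R).
Hypothesis N0 : 0 <= N.
(** The extra 1 puts an apex on the boundary of its square strictly outside the box of size [N]. *)
Let M := N + 1.
Variables (x : 'rV[R]_4).
Implicit Types z : 'rV[R]_2.
Hypothesis xc : unit_cube R 4 x.
Local Notation X k := (x 0 (inord k)).

Lemma sector_degenerate j k1 k2 z : (k1 < k2 < 3)%N ->
  (k1 <= j < k1 + 3)%N != (k2 <= j < k2 + 3)%N ->
  slope R x k1 = slope R x k2 -> ~ sector R M x j z.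
Proof.
move=> /andP[k12 k23] ne e s; have := s k1 (ltn_trans k12 k23); have := s k2 k23.
by rewrite !sideE e; case: ifP ne => _; case: ifP => // _ _; lra.
Qed.

Lemma sector_flat j z : j \in [:: 2; 5]%N -> X 1 = 1 -> ~ sector R M x j z.
Proof.
move=> j25 e s; have := s 0%N isT; have := s 2%N isT.
rewrite !sideE /slope /= e !(mulr0, mul0r, subr0, mul1r, mulr1).
by move: j25; rewrite !inE => /orP[]/eqP -> /=; lra.
Qed.

Lemma sector_below j z : `|z 0 1| <= N -> X 3 = 0 -> (3 <= j)%N -> ~ sector R M x j z.
Proof.
move=> zN e j3 s; have := s 0%N isT.
rewrite sideE /slope /= e !(mulr0, mul0r, subr0, mul1r, mulr1) ltnNge j3 /=.
by move: zN; rewrite ler_norml /M => /andP[]; lra.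
Qed.

Lemma sector_above j z : `|z 0 1| <= N -> X 3 = 1 -> (j < 3)%N -> ~ sector R M x j z.
Proof.
move=> zN e j3 s; have := s 0%N isT.
rewrite sideE /slope /= e !(mulr0, mul0r, subr0, mul1r, mulr1) j3 /=.
by move: zN; rewrite ler_norml /M => /andP[]; lra.
Qed.

Lemma slope_itv k : 0 <= slope R x k <= 1.
Proof.
have /andP[? ?] := xc (inord 0); have /andP[? ?] := xc (inord 1).
rewrite /slope; case: k => [|[|[|k]]] /=; rewrite ?lexx ?ler01 //; first last.
- by case: k => *; rewrite /= ?lexx ler01.
- by rewrite mulr_ge0 //= mulr_ile1.
Qed.

Lemma sector_left z z' : `|z 0 0| <= N -> `|z' 0 0| <= N -> X 2 = 0 ->
  sector R M x 2 z -> sector R M x 3 z' -> False.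
Proof.
move=> zN z'N e s s'; have := s 0%N isT; have := s 2%N isT.
have := s' 0%N isT; have := s' 2%N isT.
have /andP[] := slope_itv 2.
rewrite !sideE e /= [slope _ _ 0]/slope /=; set v := slope _ _ _.
rewrite !(mulr0, mul0r, subr0, mul1r, sub0r, mulrN1, opprK) => v0 v1.
set Y := z 0 1 - _; set Y' := z' 0 1 - _ => c' Y'0 c Y0.
move: zN z'N; rewrite !ler_norml => /andP[z1 z2] /andP[z1' z2'].
have V0 : 0 <= v * (1 - v) by rewrite mulr_ge0 // subr_ge0.
have h : 0 <= v * (1 - v) * (z 0 0 + M) by rewrite mulr_ge0 // /M; lra.
have h' : 0 <= v * (1 - v) * (z' 0 0 + M) by rewrite mulr_ge0 // /M; lra.
have : 0 < (1 - 2 * v) * Y by lra.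
rewrite pmulr_lgt0 // => D0.
have : 0 < (1 - 2 * v) * Y' by lra.
by rewrite pmulr_rgt0 // => ?; lra.
Qed.

Lemma sector_right z z' : `|z 0 0| <= N -> `|z' 0 0| <= N -> X 2 = 1 ->
  sector R M x 0 z -> sector R M x 5 z' -> False.
Proof.
move=> zN z'N e s s'; have := s 0%N isT; have := s 1%N isT.
have := s' 0%N isT; have := s' 1%N isT.
have /andP[] := slope_itv 1.
rewrite !sideE e /= [slope _ _ 0]/slope /=; set v := slope _ _ _.
rewrite !(mulr0, mul0r, subr0, mul1r, mulr1) => v0 v1.
set Y := z 0 1 - _; set Y' := z' 0 1 - _ => c' Y'0 c Y0.
move: zN z'N; rewrite !ler_norml => /andP[z1 z2] /andP[z1' z2'].
have V0 : 0 <= v * (1 - v) by rewrite mulr_ge0 // subr_ge0.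
have h : 0 <= v * (1 - v) * (M - z 0 0) by rewrite mulr_ge0 // /M; lra.
have h' : 0 <= v * (1 - v) * (M - z' 0 0) by rewrite mulr_ge0 // /M; lra.
have : (1 - 2 * v) * Y < 0 by lra.
rewrite pmulr_llt0 // => D0.
have : (1 - 2 * v) * Y' < 0 by lra.
by rewrite nmulr_rlt0 // => ?; lra.
Qed.

End Boundary.

(** * Assembling the contradiction *)

Theorem theorem6 (R : realType) (F : 'I_5 -> set (set 'rV[R]_2))
  (F_compact : forall i A, F i A -> compact A)
  (F_connected : forall i A, F i A -> connected A)
  (F_line : forall i1 i2 i3 : 'I_5, (i1 < i2)%N -> (i2 < i3)%N ->
    forall A1 A2 A3, F i1 A1 -> F i2 A2 -> F i3 A3 ->
    exists l : set 'rV[R]_2, [/\ is_line l, l `&` A1 !=set0,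
      l `&` A2 !=set0 & l `&` A3 !=set0]) :
  exists (i : 'I_5) (L : 'I_3 -> set 'rV[R]_2),
    [/\ k_lines L, pierces L (F i) & concurrent L \/ all_parallel L].
Proof.
apply: contrapT => notP.
have unpierced i (L : 'I_3 -> set 'rV[R]_2) : k_lines L ->
    concurrent L \/ all_parallel L -> ~ pierces L (F i).
  by move=> kL cL pL; apply: notP; exists i, L.
(* The hypothesis on increasing indices is extended to distinct indices in any order. *)
have transversal (i1 i2 i3 : 'I_5) : i1 != i2 -> i1 != i3 -> i2 != i3 ->
    forall A1 A2 A3, F i1 A1 -> F i2 A2 -> F i3 A3 ->
    exists l : set 'rV[R]_2, [/\ is_line l, l `&` A1 !=set0,
      l `&` A2 !=set0 & l `&` A3 !=set0].
  move=> n12 n13 n23 A1 A2 A3 h1 h2 h3.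
  have [[h|h]|[[h|h]|[h|h]]] : ((i1 < i2 < i3)%N \/ (i1 < i3 < i2)%N) \/
      ((i2 < i1 < i3)%N \/ (i2 < i3 < i1)%N) \/
      ((i3 < i1 < i2)%N \/ (i3 < i2 < i1)%N).
    by move: n12 n13 n23; rewrite -!val_eqE /=; lia.
  - case/andP: h => ha hb.
    by have [l [? ? ? ?]] := F_line _ _ _ ha hb _ _ _ h1 h2 h3; exists l.
  - case/andP: h => ha hb.
    by have [l [? ? ? ?]] := F_line _ _ _ ha hb _ _ _ h1 h3 h2; exists l.
  - case/andP: h => ha hb.
    by have [l [? ? ? ?]] := F_line _ _ _ ha hb _ _ _ h2 h1 h3; exists l.
  - case/andP: h => ha hb.
    by have [l [? ? ? ?]] := F_line _ _ _ ha hb _ _ _ h2 h3 h1; exists l.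
  - case/andP: h => ha hb.
    by have [l [? ? ? ?]] := F_line _ _ _ ha hb _ _ _ h3 h1 h2; exists l.
  - case/andP: h => ha hb.
    by have [l [? ? ? ?]] := F_line _ _ _ ha hb _ _ _ h3 h2 h1; exists l.
pose esc (n : nat) i := forall v l0 l1 l2 : 'rV[R]_3,
    v != 0 -> l0 != 0 -> l1 != 0 -> l2 != 0 ->
    hom_eval R l0 v = 0 -> hom_eval R l1 v = 0 -> hom_eval R l2 v = 0 ->
    exists A, [/\ F i A, in_box R n%:R A &
      [/\ misses R l0 A, misses R l1 A & misses R l2 A]].
have /choice[b Hb] i : exists b : nat, forall n, (b <= n)%N -> esc n i.
  have [b _ Hb] := unpierced_bounded _ (F i) (F_compact i) (unpierced i).
  by exists b => n /Hb.
pose n := (\max_i b i)%N.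
have {}Hb i : esc n i by apply: Hb; exact: leq_bigmax.
pose N : R := n%:R; pose M := N + 1.
have N0 : 0 <= N by exact: ler0n.
have escape i x : exists A, [/\ F i A, in_box R N A & forall k, (k < 3)%N ->
    misses R (line_form R (slope R x k) (apex R M x)) A].
  have [|||||||A [FA bA [m0 m1 m2]]] := Hb i
    (\row_j [:: apex R M x 0 0; apex R M x 0 1; 1]`_j)
    (line_form R (slope R x 0) (apex R M x))
    (line_form R (slope R x 1) (apex R M x))
    (line_form R (slope R x 2) (apex R M x)).
  - apply/eqP => /(congr1 (fun v : 'rV_3 => v 0 2)); rewrite !mxE /=.
    by apply/eqP; exact: oner_neq0.
  - exact: line_form_neq0.
  - exact: line_form_neq0.
  - exact: line_form_neq0.
  - exact: hom_eval_line_form.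
  - exact: hom_eval_line_form.
  - exact: hom_eval_line_form.
  by exists A; split=> // -[|[|[|//]]].
(* An empty set would lie in every sector. It is excluded by a transversal through it and members of
   two other families, which [escape] shows to be nonempty. *)
have nonempty i A : F i A -> A !=set0.
  move=> FA.
  have [j [k [ij ik jk]]] : exists j k : 'I_5, [/\ i != j, i != k & j != k].
    case: i {FA} => -[|[|m]] im.
    - by exists (inord 1), (inord 2); rewrite -!val_eqE /= !inordK.
    - by exists (inord 0), (inord 2); rewrite -!val_eqE /= !inordK.
    - by exists (inord 0), (inord 1); rewrite -!val_eqE /= !inordK.
  have [B [FB _ _]] := escape j 0; have [C [FC _ _]] := escape k 0.
  by have [l [_ [z [_ Az]] _ _]] := transversal _ _ _ ij ik jk _ _ _ FA FB FC; exists z.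
pose O i j := [set x | exists A, [/\ F i A, in_box R N A & A `<=` sector R M x j]].
have O_point i j x : O i j x -> exists z : 'rV[R]_2,
    [/\ `|z 0 0| <= N, `|z 0 1| <= N & sector R M x j z].
  move=> [A [FA bA As]]; have [z Az] := nonempty i A FA.
  by exists z; split; [exact: bA|exact: bA|exact: As].
have [|i x xc|i x xc e|i x xc e|i x xc e|i x xc e|i i' x xc e|i i' x xc e|i x xc e|i x xc e|
  x xc [i1 [i2 [i3 [[n12 n13 n23] H]]]]] := alternating_sectors R O.
- move=> i j; rewrite openE => x [A [FA bA As]].
  have := near_sector R M x j A (F_compact i A FA) As.
  by apply: filterS => y Ay; exists A.
- have [A [FA bA mA]] := escape i x.
  have [j j6 As] := sector_cover R M x A xc (F_connected i A FA) (nonempty i A FA) mA.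
  by exists j => //; exists A.
- have e' : slope R x 0 = slope R x 1 by rewrite /slope /= e mul0r.
  by split=> /O_point[z [_ _]]; exact: (sector_degenerate R N x _ 0%N 1%N).
- have e' : slope R x 1 = slope R x 2 by rewrite /slope /= e mul1r.
  by split=> /O_point[z [_ _]]; exact: (sector_degenerate R N x _ 1%N 2%N).
- have e' : slope R x 0 = slope R x 1 by rewrite /slope /= e mulr0.
  have e'' : slope R x 1 = slope R x 2 by rewrite /slope /= e mulr0.
  by split=> /O_point[z [_ _]]; first [exact: (sector_degenerate R N x _ 0%N 1%N)
    | exact: (sector_degenerate R N x _ 1%N 2%N)].
- by split=> /O_point[z [_ _]]; exact: sector_flat.
- move=> /O_point[z [z0 _ s]] /O_point[z' [z0' _ s']].
  exact: (sector_left R N x xc z z').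
- move=> /O_point[z [z0 _ s]] /O_point[z' [z0' _ s']].
  exact: (sector_right R N x xc z z').
- by split=> /O_point[z [_ z1]]; exact: sector_below.
- by split=> /O_point[z [_ z1]]; exact: sector_above.
have [j j2 [h1 h2 h3]] : exists2 j, (j < 2)%N &
    [/\ O i1 j x, O i2 (j + 2)%N x & O i3 (j + 4)%N x].
  by case: H => -[? ? ?]; [exists 0%N|exists 1%N].
have [A1 [FA1 _ s1]] := h1; have [A2 [FA2 _ s2]] := h2; have [A3 [FA3 _ s3]] := h3.
have [l [ll [z1 [lz1 Az1]] [z2 [lz2 Az2]] [z3 [lz3 Az3]]]] :=
  transversal _ _ _ n12 n13 n23 _ _ _ FA1 FA2 FA3.
exact: (alternating_sectors_no_line R M x l z1 z2 z3 j ll lz1 lz2 lz3 j2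
  (s1 _ Az1) (s2 _ Az2) (s3 _ Az3)).
Qed.
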